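(* Let $\mathfrak{g}=\bigoplus_{j=-r}^r\mathfrak{g}(j)$ be a graded complex simple Lie algebra with $\mathfrak{g}(1)\neq0$, let $G$ be a complex analytic group with Lie algebra $\mathfrak{g}$, and let $L$ be the analytic subgroup of $G$ with Lie algebra $\mathfrak{g}(0)$. For all $l\in L$, all $X\in\mathfrak{g}(1)$ and $0\le k\le 2r$, $$\tau_k(\mathrm{Ad}(l)X)=(\mathrm{Ad}(l)\otimes\mathrm{Ad}(l))\,\tau_k(X).$$
   Context: $\kappa$ is the Killing form. $\omega=\sum_jX_j^*\otimes X_j\in\mathfrak{g}(-r)\otimes\mathfrak{g}(r)$, where $\{X_j\}$ is a basis of $\mathfrak{g}(r)$ (e.g. of root vectors) and $\{X_j^*\}$ is the dual basis of $\mathfrak{g}(-r)$ with respect to $\kappa$, i.e. $\kappa(X_j^*,X_t)=\delta_{j,t}$ ($\omega$ does not depend on the basis). $\tau_k:\mathfrak{g}(1)\to\mathfrak{g}(-r+k)\otimes\mathfrak{g}(r)$ is defined by $\tau_k(X)=\frac{1}{k!}\big(\mathrm{ad}(X)^k\otimes\mathrm{Id}\big)\omega$. *)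

(* Defs.v *)
From HB Require Import structures.
From mathcomp Require Import all_boot all_order all_algebra.
From mathcomp Require Import complex mxtens.
From mathcomp Require Import all_classical all_reals all_analysis.

Set Implicit Arguments.
Unset Strict Implicit.
Unset Printing Implicit Defensive.

Import Order.TTheory GRing.Theory Num.Theory.
Import numFieldNormedType.Exports.
Import passmx.

Local Open Scope classical_set_scope.
Local Open Scope ring_scope.

HB.mixin Record isLieAlgebra (K : fieldType) g of Vector K g := {
  lie : g -> g -> g;
  lie_linearr : forall X, linear (lie X);
  lie_linearl : forall Y, linear (lie ^~ Y);
  liexx : forall X, lie X X = 0;
  lie_jacobi : forall X Y Z,
    lie X (lie Y Z) + lie Y (lie Z X) + lie Z (lie X Y) = 0
}.

#[short(type="lieAlgType")]
HB.structure Definition LieAlgebra (K : fieldType) :=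
  {g of isLieAlgebra K g & Vector K g}.

Section LieAlgebraTheory.
Context {K : fieldType} {g : lieAlgType K}.

Definition ad (X : g) : 'End(g) := linfun (lie X).

Definition ad_pow (X : g) (k : nat) : 'End(g) := iter k (comp_lfun (ad X)) \1%VF.

Definition endo_tr (f : 'End(g)) : K :=
  \tr (mxof (vbasis {:g}) (vbasis {:g}) f).

Definition killing (X Y : g) : K := endo_tr (ad X \o ad Y)%VF.

Definition lie_ideal (I : {vspace g}) : Prop :=
  forall X Y : g, Y \in I -> lie X Y \in I.

Definition lie_simple : Prop :=
  (exists X Y : g, lie X Y != 0) /\
  (forall I : {vspace g}, lie_ideal I -> I = 0%VS \/ I = fullv).

(* The pieces gr j with |j| > r, which do not occur in the sum, are zero. *)
Record lie_grading (r : nat) (gr : int -> {vspace g}) : Prop := LieGrading {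
  grading_bound : forall j : int, (r < `|j|)%N -> gr j = 0%VS;
  grading_direct : directv (\sum_(i < (2 * r).+1) gr (i%:Z - r%:Z))%VS;
  grading_full : (\sum_(i < (2 * r).+1) gr (i%:Z - r%:Z))%VS = fullv;
  grading_lie : forall (i j : int) (X Y : g),
    X \in gr i -> Y \in gr j -> lie X Y \in gr (i + j)
}.

End LieAlgebraTheory.

Arguments lie_simple {K} g.

(* The tensor product U (x) V is modelled on row vectors of length
   dim U * dim V: pure tensors and tensor products of endomorphisms are the
   Kronecker products of coordinate vectors and matrices in the bases
   vbasis {:U} and vbasis {:V}. *)
Notation tensor K U V := 'rV[K]_(\dim {:U} * \dim {:V}).

Section Tensor.
Context {K : fieldType} {U V : vectType K}.

Definition tensv (u : U) (v : V) : tensor K U V :=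
  rVof (vbasis {:U}) u *t rVof (vbasis {:V}) v.

Definition tens_hom (f : 'End(U)) (h : 'End(V))
    (w : tensor K U V) : tensor K U V :=
  w *m (mxof (vbasis {:U}) (vbasis {:U}) f *t mxof (vbasis {:V}) (vbasis {:V}) h).

Lemma tens_homE f h u v : tens_hom f h (tensv u v) = tensv (f u) (h v).
Proof.
rewrite /tens_hom /tensv.
rewrite (rVof_app (vbasis _) (vbasisP {:U})) (rVof_app (vbasis _) (vbasisP {:V})).
exact: (@tensmx_mul K 1 _ 1).
Qed.

Lemma tensv_basis (i : 'I_(\dim {:U})) (j : 'I_(\dim {:V})) :
  tensv (vbasis {:U})`_i (vbasis {:V})`_j =
  delta_mx 0 (mxtens_index (i, j)).
Proof.
apply/rowP => l; case: (mxtens_indexP l) => i' j'.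
rewrite /tensv !rVofE ?vbasisP // mxE !mxtens_indexK /= !mxE /=.
rewrite (can_eq (@mxtens_indexK _ _)) xpair_eqE.
by do 2!case: eqP => _ //=; rewrite ?mulr1 ?mulr0 ?mul0r // ?andbF.
Qed.

End Tensor.

Section Tau.
Context {K : fieldType} {g : lieAlgType K}.

Definition killing_dual_bases (d : nat) (gneg gpos : {vspace g})
    (Xs Xb : d.-tuple g) : Prop :=
  [/\ basis_of gpos Xb, basis_of gneg Xs &
      forall j t : 'I_d, killing (tnth Xs j) (tnth Xb t) = (j == t)%:R].

Definition omega (d : nat) (Xs Xb : d.-tuple g) : tensor K g g :=
  \sum_(j < d) tensv (tnth Xs j) (tnth Xb j).

Definition tau (d : nat) (Xs Xb : d.-tuple g) (k : nat) (X : g) :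
    tensor K g g :=
  (k`!%:R)^-1 *: tens_hom (ad_pow X k) \1%VF (omega Xs Xb).

End Tau.

(* Needed for matrices over R[i] to be found as topological spaces. *)
HB.instance Definition _ (R : realType) := PseudoPointedMetric.copy R[i] R[i]^o.

(* Holomorphy is taken in the form "of class C^k over the complex numbers for
   all k"; by Cauchy's formula this is complex differentiability at every
   point of the open set U. *)
Section Holomorphic.
Context {R : realType} {V W : normedModType R[i]}.

Fixpoint class_C (k : nat) (U : set V) (f : V -> W) : Prop :=
  match k with
  | 0 => forall x, U x -> {for x, continuous f}
  | k'.+1 => (forall x, U x -> differentiable f x) /\
             (forall v : V, class_C k' U (fun x => 'd f x v))
  end.

Definition holomorphic (U : set V) (f : V -> W) : Prop :=
  forall k : nat, class_C k U f.

End Holomorphic.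

(* cinv is only meaningful on the open set cmap @` cdom. *)
Record chart (R : realType) (n : nat) (T : topologicalType) := Chart {
  cdom : set T;
  cmap :> T -> 'rV[R[i]]_n;
  cinv : 'rV[R[i]]_n -> T;
  cdom_open : open cdom;
  cimg_open : open (cmap @` cdom);
  cmapK : forall p, cdom p -> cinv (cmap p) = p;
  cmap_continuous : forall p, cdom p -> {for p, continuous cmap};
  cinv_continuous : forall p, cdom p -> {for cmap p, continuous cinv}
}.

(* The atlas is the family of charts chart_at p; the tangent space at p is
   identified with C^n through the chart chart_at p. *)
HB.mixin Record isComplexManifold (R : realType) (n : nat) M
    of Topological M := {
  manifold_hausdorff : hausdorff_space M;
  chart_at : M -> chart R n M;
  chart_at_dom : forall p, cdom (chart_at p) p;
  chart_compat : forall p q,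
    holomorphic (chart_at p @` (cdom (chart_at p) `&` cdom (chart_at q)))
                (chart_at q \o cinv (chart_at p))
}.

#[short(type="complexManifoldType")]
HB.structure Definition ComplexManifold (R : realType) (n : nat) :=
  {M of isComplexManifold R n M & Topological M}.

Section Manifolds.
Context {R : realType} {m n : nat}.
Context {M : complexManifoldType R m} {N : complexManifoldType R n}.

Definition local_rep (f : M -> N) (p : M) (q : N) : 'rV[R[i]]_m -> 'rV[R[i]]_n :=
  chart_at q \o f \o cinv (chart_at p).

Definition holomorphic_map (f : M -> N) : Prop :=
  continuous f /\
  forall p q,
    holomorphic (chart_at p @` (cdom (chart_at p) `&` f @^-1` cdom (chart_at q)))
                (local_rep f p q).

Definition mdiff (f : M -> N) (p : M) : 'rV[R[i]]_m -> 'rV[R[i]]_n :=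
  'd (local_rep f p (f p)) (chart_at p p).

End Manifolds.

(* Holomorphy of the multiplication is expressed in the product charts of
   G * G. *)
HB.mixin Record isComplexLieGroup (R : realType) (n : nat) G
    of ComplexManifold R n G & Group G := {
  mulg_continuous : continuous (fun x : G * G => (x.1 * x.2)%g);
  mulg_holomorphic : forall p q s : G,
    holomorphic
      [set (chart_at p x.1, chart_at q x.2) | x in
        [set x : G * G | [/\ cdom (chart_at p) x.1, cdom (chart_at q) x.2 &
                             cdom (chart_at s) (x.1 * x.2)%g]]]
      (fun u : 'rV[R[i]]_n * 'rV[R[i]]_n =>
        chart_at s (cinv (chart_at p) u.1 * cinv (chart_at q) u.2)%g);
  invg_holomorphic : holomorphic_map (fun x : G => x^-1%g)
}.

#[short(type="complexLieGroupType")]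
HB.structure Definition ComplexLieGroup (R : realType) (n : nat) :=
  {G of isComplexLieGroup R n G & ComplexManifold R n G & Group G}.

Section Adjoint.
Context {R : realType} {n : nat} (G : complexLieGroupType R n).

Definition tangent_Ad (x : G) : 'rV[R[i]]_n -> 'rV[R[i]]_n :=
  'd (local_rep (fun y : G => x * y * x^-1)%g 1%g 1%g) (chart_at 1%g (1%g : G)).

(* Bracket of the Lie algebra of G: [v, w] = ad(v)(w), where ad is the
   differential at 1 of Ad. *)
Definition tangent_lie (v w : 'rV[R[i]]_n) : 'rV[R[i]]_n :=
  'd (fun u => tangent_Ad (cinv (chart_at (1%g : G)) u) w)
     (chart_at 1%g (1%g : G)) v.

Context {g : lieAlgType R[i]}.

(* lambda identifies g with the Lie algebra of G. *)
Definition lie_algebra_iso (lambda : 'Hom(g, 'rV[R[i]]_n)) : Prop :=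
  bijective lambda /\
  forall X Y : g, lambda (lie X Y) = tangent_lie (lambda X) (lambda Y).

Definition Ad (lambda : 'Hom(g, 'rV[R[i]]_n)) (x : G) : 'End(g) :=
  (lambda^-1 \o linfun (tangent_Ad x) \o lambda)%VF.

(* L carries the topology and complex structure of H, which may be finer than
   those induced by G: analytic subgroups need not be closed. *)
Definition analytic_subgroup (lambda : 'Hom(g, 'rV[R[i]]_n)) (h : {vspace g})
    (L : set G) : Prop :=
  exists (m : nat) (H : complexLieGroupType R m) (iota : {multiplicative H -> G}),
    [/\ connected [set: H],
        injective iota /\ range iota = L,
        holomorphic_map iota,
        forall p : H, injective (mdiff iota p) &
        limg (linfun (mdiff iota (1%g : H))) = (lambda @: h)%VS].

End Adjoint.

(* Main.v *)
(** Since [Ad l] is a Lie algebra automorphism,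
    [(ad (Ad l X))^k (x) 1] applied to [(Ad l (x) Ad l) omega] is
    [(Ad l (x) Ad l) ((ad X)^k (x) 1) omega], so it is enough to see that
    [L] fixes [omega].  Invariance of the Killing form says that
    [ad v (x) 1 + 1 (x) ad v] kills [omega] for [v] in [g(0)]; hence the
    orbit map [h |-> (Ad h (x) Ad h) omega] on the connected group underlying
    [L] has zero differential at [1], by translation near [1], and so it is
    constant near [1].  The stabilizer of [omega] is then an open, hence
    closed, subgroup.

    That [Ad] is differentiable at [1] comes from writing it, in charts, with
    first partial differentials of the multiplication, which is [C^2]. *)
From HB Require Import structures.
Require Import Defs.
From mathcomp Require Import all_boot all_order all_algebra.
From mathcomp Require Import complex mxtens.
From mathcomp Require Import all_classical all_reals all_analysis.

Set Implicit Arguments.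
Unset Strict Implicit.
Unset Printing Implicit Defensive.
Import Order.TTheory GRing.Theory Num.Theory.
Import numFieldNormedType.Exports.
Import passmx.

Local Open Scope classical_set_scope.
Local Open Scope ring_scope.

Section Differentials.
Context {K : numFieldType}.

Lemma is_diff_near_eq (V W : normedModType K) (f g : V -> W) (x : V) :
  (\near x, f x = g x) -> differentiable f x -> is_diff x g ('d f x).
Proof.
move=> fg df; have fgx : f x = g x := nbhs_singleton fg.
have cf := diff_continuous df.
have E : g \o shift x = cst (g x) + 'd f x +o_ 0 id.
  apply/eqaddoP => _/posnumP[e].
  have := diff_locally df; move/eqaddoP => /(_ e%:num (gt0 e)) near_f.
  have near_fg : \forall y \near 0, f (y + x) = g (y + x).
    by move: fg; rewrite (near_shift 0 x) subr0.
  apply: filterS2 near_f near_fg => y /= + fgy.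
  by rewrite !fctE /= fgy fgx.
apply: DiffDef (diff_unique cf E).
apply/diff_locallyP; rewrite (diff_unique cf E).
by split; [exact: cf|exact: E].
Qed.

Lemma differentiable_rV (V : normedModType K) n (F : V -> 'rV[K]_n) (x : V) :
  (forall j, differentiable (fun y => F y 0 j : K^o) x) -> differentiable F x.
Proof.
move=> dF.
have -> : F = \sum_(j < n) (fun y => F y 0 j *: delta_mx 0 j).
  by apply/funext => y; rewrite fct_sumE [LHS]row_sum_delta.
by apply: differentiable_sum => j; exact: differentiableZl.
Qed.

Lemma is_diff_sum (V W : normedModType K) n (f df : 'I_n -> V -> W) (x : V) :
  (forall i, is_diff x (f i) (df i)) ->
  is_diff x (\sum_(i < n) f i) (\sum_(i < n) df i).
Proof.
move=> dfi; elim/big_ind2 : _ => [||i _]; [|move=> ? ? ? ? ? ?|exact: dfi].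
  exact: is_diff_cst.
exact: is_diffD.
Qed.

Lemma linear_rV_continuous (W : normedModType K) n (phi : {linear 'rV[K]_n -> W}) :
  continuous phi.
Proof.
move=> x; apply: differentiable_continuous.
have -> : phi = \sum_(j < n) (fun y : 'rV[K]_n => y 0 j *: phi (delta_mx 0 j)) :> (_ -> _).
  apply/funext => y; rewrite fct_sumE [in LHS](row_sum_delta y) linear_sum.
  by apply: eq_bigr => j _; rewrite linearZ.
apply: differentiable_sum => j.
exact/differentiableZl/differentiable_coord.
Qed.

Lemma is_diff_coord n j (M : 'rV[K]_n) :
  is_diff M (fun N : 'rV[K]_n => N 0 j : K^o) (fun N => N 0 j).
Proof.
have lin_j : linear (fun N : 'rV[K]_n => N 0 j : K^o) by move=> ? ? ?; rewrite !mxE.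
pose coord_j : {linear 'rV[K]_n -> K^o} :=
  HB.pack (fun N : 'rV[K]_n => N 0 j : K^o) (GRing.isLinear.Build _ _ _ _ _ lin_j).
have cc : continuous coord_j by exact: linear_rV_continuous.
exact: DiffDef (linear_differentiable _ cc) (diff_lin _ cc).
Qed.

Lemma is_diff_rV (V : normedModType K) n (F D : V -> 'rV[K]_n) (x : V) :
  (forall j, is_diff x (fun y => F y 0 j : K^o) (fun v => D v 0 j)) ->
  is_diff x F D.
Proof.
move=> dF; have dFx : differentiable F x.
  by apply: differentiable_rV => j; have := dF j => -[].
apply: DiffDef => //; apply/funext => v; apply/rowP => j.
have [_ Dj] := dF j.
have [_ Ej] := is_diff_comp (differentiableP dFx) (is_diff_coord j (F x)).
exact: (congr1 (@^~ v) (etrans (esym Ej) Dj)).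
Qed.

Lemma differentiable_linear_app (V : normedModType K) m p
    (A : V -> 'rV[K]_m -> 'rV[K]_p) (F : V -> 'rV[K]_m) (x : V) :
  (forall y, linear (A y)) ->
  (forall w, differentiable (A ^~ w) x) -> differentiable F x ->
  differentiable (fun y => A y (F y)) x.
Proof.
move=> linA dA dF; apply: differentiable_rV => j.
have -> : (fun y => A y (F y) 0 j : K^o) =
    \sum_(i < m) ((fun y => F y 0 i : K^o) * (fun y => A y (delta_mx 0 i) 0 j : K^o)).
  apply/funext => y; rewrite fct_sumE.
  pose Ay : {linear 'rV[K]_m -> 'rV[K]_p} :=
    HB.pack (A y) (GRing.isLinear.Build _ _ _ _ _ (linA y)).
  rewrite -[A y]/(Ay : _ -> _) [in LHS](row_sum_delta (F y)) linear_sum summxE.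
  by apply: eq_bigr => i _; rewrite linearZ mxE.
apply: differentiable_sum => i; apply: differentiableM.
  exact: (differentiable_comp dF (differentiable_coord _ _ _)).
exact: (differentiable_comp (dA _) (differentiable_coord _ _ _)).
Qed.

End Differentials.

Lemma near_growth_rate_lt (K : numFieldType) (V W : normedModType K)
    (f : V -> W) (y v : V) : is_diff y f 0 ->
  forall e : K, 0 < e ->
    \forall h \near (0 : K)^', `|h^-1 *: (f (h *: v + y) - f y)| < e.
Proof.
move=> dy; have dfy : differentiable f y by exact: ex_diff.
have Dfy : 'D_v f y = 0 by rewrite deriveE // diff_val.
have := @diff_derivable _ _ _ f y v dfy; rewrite /derivable -/(derive f y v) Dfy.
by move/cvgr0Pnorm_lt.
Qed.

Section ZeroDifferential.
Context {R : realType} {V : normedModType R[i]}.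

Lemma Re_norm_le (z : R[i]) : `|complex.Re z| <= complex.Re `|z|.
Proof.
by case: z => a b; rewrite /= -[leLHS]sqrtr_sqr ler_wsqrtr // ?lerDl ?sqr_ge0.
Qed.

Lemma cvg_real_complex_dnbhs0 :
  (fun h : R => h%:C%C : R[i]^o) @ (0 : R)^' --> (0 : R[i]^o)^'.
Proof.
move=> A /nbhs_ballP [e e0 eA].
have Ie : complex.Im e = 0 by apply: ger0_Im; exact: ltW.
have Re0 : 0 < complex.Re e by move: e0; rewrite /= ltcE => /andP[].
apply/nbhs_ballP; exists (complex.Re e) => //= h; rewrite /ball /= sub0r normrN => he h0.
apply: eA; last by apply: contra_neq h0 => /complexI.
by rewrite /ball /= sub0r normrN ltcE /= Ie eqxx /= expr0n /= addr0 sqrtr_sqr.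
Qed.

Lemma is_derive0_Re_segment (f : V -> R[i]^o) (x v : V) (t : R) :
  is_diff (x + t%:C%C *: v) f 0 ->
  is_derive t 1 (fun t : R => complex.Re (f (x + t%:C%C *: v))) 0.
Proof.
move=> df; set y := x + t%:C%C *: v.
suff c : (h^-1 *: (((fun t => complex.Re (f (x + t%:C%C *: v))) \o shift t) (h *: 1) -
     complex.Re (f y)) : R) @[h --> 0^'] --> (0 : R).
  by apply: DeriveDef; [exact: cvgP c | exact: cvg_lim c].
apply/cvgr0Pnorm_lt => e e0.
have eC0 : 0 < (e%:C%C : R[i]) by rewrite ltcR.
have small : \forall h \near (0 : R)^',
    `|(h%:C%C)^-1 *: (f (h%:C%C *: v + y) - f y)| < e%:C%C.
  exact: cvg_real_complex_dnbhs0 (near_growth_rate_lt v df eC0).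
apply: filterS small => h /=; rewrite ltcE => /andP[_].
apply: le_lt_trans; apply: le_trans (Re_norm_le _).
have -> : x + (h *: 1 + t)%:C%C *: v = h%:C%C *: v + y.
  by rewrite /y [h *: 1]mulr1 rmorphD scalerDl addrCA.
rewrite -fmorphV; set w := f _ - f y.
rewrite (_ : h^-1 *: _ = complex.Re (h^-1%:C%C *: w)) //.
rewrite [_ *: w]/(_ * w) /w; case: (f _) => a b; case: (f y) => c d /=.
by rewrite mul0r subr0.
Qed.

Lemma diff0_segment (f : V -> R[i]^o) (x v : V) :
  (forall t : R, 0 <= t <= 1 -> is_diff (x + t%:C%C *: v) f 0) ->
  f (x + v) = f x.
Proof.
move=> df.
have Ref (f' : V -> R[i]^o) :
    (forall t : R, 0 <= t <= 1 -> is_diff (x + t%:C%C *: v) f' 0) ->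
    complex.Re (f' (x + v)) = complex.Re (f' x).
  move=> df'; pose phi (t : R) := complex.Re (f' (x + t%:C%C *: v)).
  have dphi (t : R) : t \in `[0, 1]%R -> is_derive t 1 phi 0.
    by rewrite in_itv /= => /df' /is_derive0_Re_segment.
  have oo_phi (t : R) : t \in `]0, 1[%R -> is_derive t 1 phi (cst 0 t).
    by move=> /subset_itv_oo_cc/dphi.
  have cphi : {within `[0, 1], continuous phi}.
    by apply: derivable_within_continuous => t /dphi dt; exact: ex_derive.
  have [c _] := MVT (@ltr01 R) oo_phi cphi.
  by rewrite mul0r /phi rmorph0 rmorph1 scale0r addr0 scale1r => /subr0_eq.
apply/eqP; rewrite eq_complex; apply/andP; split; apply/eqP; first exact: Ref.
pose g : V -> R[i]^o := (- 'i%C : R[i]) *: f.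
have dg t : 0 <= t <= 1 -> is_diff (x + t%:C%C *: v) g 0.
  by move=> t01; have ? := df t t01; apply: is_diff_eq (scaler0 _ _).
have E z : complex.Re (g z) = complex.Im (f z).
  rewrite /g; change (complex.Re ((- 'i%C : R[i]) * f z) = complex.Im (f z)).
  by case: (f z) => a b /=; rewrite oppr0 mul0r sub0r mulN1r opprK.
by rewrite -!E; exact: Ref.
Qed.

Lemma diff0_near_cst (f : V -> R[i]^o) (x : V) :
  (\forall y \near x, is_diff y f 0) -> \forall y \near x, f y = f x.
Proof.
move=> /nbhs_ballP [e /= e0 df]; apply/nbhs_ballP; exists e => //= y.
rewrite -ball_normE /= => xy; rewrite -[in LHS](subrKC x y).
apply: diff0_segment => t /andP[t0 t1]; apply: df.
rewrite -ball_normE /= opprD addNKr normrN normrZ -opprB normrN.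
apply: le_lt_trans xy; rewrite ler_piMl // ger0_norm ?ler0c //.
by rewrite -[leRHS]/(1%:C%C) lecR.
Qed.

End ZeroDifferential.

Section Charts.
Context {R : realType}.

Lemma cdom_near n (T : topologicalType) (c : chart R n T) (p : T) :
  cdom c p -> \forall x \near p, cdom c x.
Proof. by move=> cp; apply: open_nbhs_nbhs; split => //; exact: cdom_open. Qed.

Lemma cinv_near n (T : topologicalType) (c : chart R n T) (p : T) (P : set T) :
  cdom c p -> (\forall x \near p, P x) -> \forall u \near c p, P (cinv c u).
Proof.
by move=> cp nP; apply: (cinv_continuous cp); rewrite cmapK.
Qed.

Lemma cinvK_near n (T : topologicalType) (c : chart R n T) (p : T) :
  cdom c p -> \forall u \near c p, c (cinv c u) = u.
Proof.
move=> cp; have : nbhs (c p) (c @` cdom c).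
  by apply: open_nbhs_nbhs; split; [exact: cimg_open | exists p].
by apply: filterS => _ [x cx <-]; rewrite cmapK.
Qed.

Lemma local_rep_comp m1 m2 m3 (M1 : complexManifoldType R m1)
    (M2 : complexManifoldType R m2) (M3 : complexManifoldType R m3)
    (f : M1 -> M2) (g : M2 -> M3) (p a : M1) (q b : M2) (s : M3)
    (df : 'rV[R[i]]_m1 -> 'rV[R[i]]_m2) (dg : 'rV[R[i]]_m2 -> 'rV[R[i]]_m3) :
  f a = b -> cdom (chart_at p) a -> cdom (chart_at q) b -> {for a, continuous f} ->
  is_diff (chart_at p a) (local_rep f p q) df ->
  is_diff (chart_at q b) (local_rep g q s) dg ->
  is_diff (chart_at p a) (local_rep (g \o f) p s) (dg \o df).
Proof.
move=> fab pa qb cf Df; rewrite -fab => Dg; rewrite -fab in qb.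
have fa : local_rep f p q (chart_at p a) = chart_at q (f a).
  by rewrite /local_rep /= cmapK.
rewrite -fa in Dg; have [dgf Egf] := is_diff_comp Df Dg.
have near_gf : \forall u \near chart_at p a,
    (local_rep g q s \o local_rep f p q) u = local_rep (g \o f) p s u.
  have : \forall x \near a, cdom (chart_at q) (f x) by exact: cf (cdom_near qb).
  move/(cinv_near pa); apply: filterS => u qu.
  by rewrite /local_rep /= cmapK.
have [d E] := is_diff_near_eq near_gf dgf.
by apply: DiffDef d _; rewrite E Egf.
Qed.

End Charts.

Section LieGroup.
Context {R : realType} {n : nat} {G : complexLieGroupType R n}.
Implicit Types (a b p q s x y : G).

Definition chart_mul p q s (u : 'rV[R[i]]_n * 'rV[R[i]]_n) : 'rV[R[i]]_n :=
  chart_at s (cinv (chart_at p) u.1 * cinv (chart_at q) u.2)%g.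

Lemma chart_mul_C2 p q s a b : cdom (chart_at p) a -> cdom (chart_at q) b ->
  cdom (chart_at s) (a * b)%g ->
  differentiable (chart_mul p q s) (chart_at p a, chart_at q b) /\
  forall w, differentiable (fun z => 'd (chart_mul p q s) z w)
    (chart_at p a, chart_at q b).
Proof.
move=> pa qb sab.
have [d1 d2] := @mulg_holomorphic R n G p q s 2.
split; first by apply: d1; exists (a, b).
by move=> w; have [d3 _] := d2 w; apply: d3; exists (a, b).
Qed.

Lemma lmulg_continuous a : continuous (fun x => a * x)%g.
Proof.
move=> b; apply: (@continuous_comp _ _ _ (fun x => (a, x)) (fun z => z.1 * z.2)%g).
  by apply: cvg_pair; [exact: cvg_cst | exact: cvg_id].
exact: mulg_continuous.
Qed.

Lemma rmulg_continuous a : continuous (fun x => x * a)%g.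
Proof.
move=> b; apply: (@continuous_comp _ _ _ (fun x => (x, a)) (fun z => z.1 * z.2)%g).
  by apply: cvg_pair; [exact: cvg_id | exact: cvg_cst].
exact: mulg_continuous.
Qed.

Lemma is_diff_lmulg p q s a b : cdom (chart_at p) a -> cdom (chart_at q) b ->
  cdom (chart_at s) (a * b)%g ->
  is_diff (chart_at q b) (local_rep (fun x => a * x)%g q s)
    (fun w => 'd (chart_mul p q s) (chart_at p a, chart_at q b) (0, w)).
Proof.
move=> pa qb sab; have [d _] := chart_mul_C2 pa qb sab.
have -> : local_rep (fun x => a * x)%g q s =
    chart_mul p q s \o (fun u => (cst (chart_at p a) u, id u)).
  by apply/funext => u; rewrite /local_rep /chart_mul /= cmapK.
have dpair : is_diff (chart_at q b)
    (fun u => (cst (chart_at p a) u, id u)) (fun w => (0, w)).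
  exact: is_diff_pair.
exact: (is_diff_comp dpair (differentiableP d)).
Qed.

Lemma is_diff_rmulg p q s a b : cdom (chart_at p) a -> cdom (chart_at q) b ->
  cdom (chart_at s) (a * b)%g ->
  is_diff (chart_at p a) (local_rep (fun x => x * b)%g p s)
    (fun w => 'd (chart_mul p q s) (chart_at p a, chart_at q b) (w, 0)).
Proof.
move=> pa qb sab; have [d _] := chart_mul_C2 pa qb sab.
have -> : local_rep (fun x => x * b)%g p s =
    chart_mul p q s \o (fun u => (id u, cst (chart_at q b) u)).
  by apply/funext => u; rewrite /local_rep /chart_mul /= cmapK.
have dpair : is_diff (chart_at p a)
    (fun u => (id u, cst (chart_at q b) u)) (fun w => (w, 0)).
  exact: is_diff_pair.
exact: (is_diff_comp dpair (differentiableP d)).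
Qed.

Definition conj_by x y : G := (x * y * x^-1)%g.

Lemma conj_by_continuous x : continuous (conj_by x).
Proof.
move=> y; apply: (@continuous_comp _ _ _ (fun y => x * y)%g (fun y => y * x^-1)%g).
  exact: lmulg_continuous.
exact: rmulg_continuous.
Qed.

Lemma is_diff_conj s t x : cdom (chart_at s) x -> cdom (chart_at t) x^-1%g ->
  is_diff (chart_at 1%g (1%g : G)) (local_rep (conj_by x) 1%g 1%g)
    (fun w => 'd (chart_mul s t 1%g) (chart_at s x, chart_at t x^-1%g)
       ('d (chart_mul s 1%g s) (chart_at s x, chart_at 1%g (1%g : G)) (0, w), 0)).
Proof.
move=> sx tx; have d1 : cdom (chart_at (1%g : G)) 1%g := chart_at_dom _.
have sx1 : cdom (chart_at s) (x * 1)%g by rewrite mulg1.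
have d1' : cdom (chart_at (1%g : G)) (x * x^-1)%g by rewrite mulgV.
exact: (local_rep_comp (mulg1 x) d1 sx (@lmulg_continuous x 1%g)
  (is_diff_lmulg sx d1 sx1) (is_diff_rmulg sx tx d1')).
Qed.

Lemma conj_by_diff x :
  differentiable (local_rep (conj_by x) 1%g 1%g) (chart_at 1%g (1%g : G)).
Proof.
by have [] := is_diff_conj (chart_at_dom x) (chart_at_dom x^-1%g).
Qed.

Lemma conj_by1 x : conj_by x 1%g = 1%g.
Proof. by rewrite /conj_by mulg1 mulgV. Qed.

Lemma tangent_AdM x y w : tangent_Ad (x * y)%g w = tangent_Ad x (tangent_Ad y w).
Proof.
have d1 : cdom (chart_at (1%g : G)) 1%g := chart_at_dom _.
have := local_rep_comp (conj_by1 y) d1 d1 (@conj_by_continuous y 1%g)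
  (differentiableP (conj_by_diff y)) (differentiableP (conj_by_diff x)).
have <- : conj_by (x * y)%g = conj_by x \o conj_by y.
  by apply/funext => z; rewrite /conj_by /= invgM !mulgA.
by move=> [_ /(congr1 (@^~ w))].
Qed.

Lemma tangent_Ad1 w : tangent_Ad (1%g : G) w = w.
Proof.
have d1 : cdom (chart_at (1%g : G)) 1%g := chart_at_dom _.
have E : \forall u \near chart_at (1%g : G) 1%g,
    id u = local_rep (fun y : G => 1 * y * 1^-1)%g 1%g 1%g u.
  apply: filterS (cinvK_near d1) => u Hu.
  by rewrite /local_rep /= invg1 mulg1 mul1g Hu.
have [_ ] := is_diff_near_eq E (@ex_diff _ _ _ _ _ _ _ (is_diff_id _)).
by rewrite /tangent_Ad => ->; rewrite diff_val.
Qed.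

Lemma tangent_Ad_near : \forall u \near chart_at (1%g : G) 1%g, forall w,
  tangent_Ad (cinv (chart_at (1%g : G)) u) w =
  'd (chart_mul 1%g 1%g 1%g) (u, local_rep (fun x : G => x^-1)%g 1%g 1%g u)
    ('d (chart_mul 1%g 1%g 1%g) (u, chart_at 1%g (1%g : G)) (0, w), 0).
Proof.
have d1 : cdom (chart_at (1%g : G)) 1%g := chart_at_dom _.
have d1V : cdom (chart_at (1%g : G)) 1^-1%g by rewrite invg1.
have n1 := cinv_near d1 (cdom_near d1).
have nV : \forall x \near (1%g : G), cdom (chart_at (1%g : G)) x^-1%g.
  exact: (invg_holomorphic.1 1%g _ (cdom_near d1V)).
have := cinv_near d1 nV; have := cinvK_near d1.
apply: filterS3 n1 => u ux uK uV w.
have [_ D] := is_diff_conj ux uV.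
by rewrite /tangent_Ad D /local_rep /= uK.
Qed.

Lemma differentiable_tangent_Ad w :
  differentiable (fun u => tangent_Ad (cinv (chart_at (1%g : G)) u) w)
    (chart_at 1%g (1%g : G)).
Proof.
set u0 := chart_at _ _; pose inv := local_rep (fun x : G => x^-1)%g 1%g 1%g.
have d1 : cdom (chart_at (1%g : G)) 1%g := chart_at_dom _.
have d1M : cdom (chart_at (1%g : G)) (1 * 1)%g by rewrite mulg1.
have inv_u0 : inv u0 = u0 by rewrite /inv /local_rep /u0 /= cmapK // invg1.
have inv_diff : differentiable inv u0.
  have [_ /(_ 1%g 1%g 1%N) [dinv _]] := @invg_holomorphic R n G.
  by apply: dinv; exists 1%g => //; split => //=; rewrite invg1.
have [_ C2] := chart_mul_C2 d1 d1 d1M.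
pose A u w' := 'd (chart_mul 1%g 1%g 1%g) (u, inv u) (w', 0).
pose F u := 'd (chart_mul 1%g 1%g 1%g) (u, u0) (0, w).
have linA u : linear (A u).
  move=> k a b; rewrite /A.
  have -> : (k *: a + b, 0) = k *: (a, 0) + (b, 0) :> 'rV[R[i]]_n * 'rV[R[i]]_n.
    by apply/pair_equal_spec; split => //=; rewrite [k *: 0]scaler0 addr0.
  exact: linearP.
have dF : differentiable F u0.
  apply: (@differentiable_comp _ _ _ _ (fun u => (u, u0))
    (fun z => 'd (chart_mul 1%g 1%g 1%g) z (0, w))); last exact: C2.
  exact: differentiable_pair.
have dA w' : differentiable (A ^~ w') u0.
  apply: (@differentiable_comp _ _ _ _ (fun u => (u, inv u))
    (fun z => 'd (chart_mul 1%g 1%g 1%g) z (w', 0))).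
    exact: differentiable_pair.
  by rewrite inv_u0.
have dAF := differentiable_linear_app linA dA dF.
have near_AF : \forall u \near u0, A u (F u) =
    tangent_Ad (cinv (chart_at (1%g : G)) u) w.
  by apply: filterS tangent_Ad_near => u ->.
by have [] := is_diff_near_eq near_AF dAF.
Qed.

Lemma is_diff_tangent_Ad w :
  is_diff (chart_at 1%g (1%g : G))
    (fun u => tangent_Ad (cinv (chart_at (1%g : G)) u) w) (tangent_lie G ^~ w).
Proof. exact: DiffDef (differentiable_tangent_Ad w) _. Qed.

Lemma tangent_Ad_lie x v w : tangent_Ad x (tangent_lie G v w) =
  tangent_lie G (tangent_Ad x v) (tangent_Ad x w).
Proof.
have d1 : cdom (chart_at (1%g : G)) 1%g := chart_at_dom _.
have Ad_cont : continuous ('d (local_rep (conj_by x) 1%g 1%g) (chart_at 1%g (1%g : G))).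
  exact: diff_continuous (conj_by_diff x).
have dl : is_diff (chart_at 1%g (1%g : G))
    (fun u => tangent_Ad x (tangent_Ad (cinv (chart_at (1%g : G)) u) w))
    (fun v => tangent_Ad x (tangent_lie G v w)).
  have dAd (z : 'rV[R[i]]_n) : is_diff z (tangent_Ad x) (tangent_Ad x).
    by apply: DiffDef;
      [exact: (linear_differentiable _ Ad_cont) | exact: (diff_lin _ Ad_cont)].
  exact: is_diff_comp (is_diff_tangent_Ad w) (dAd _).
have c1 : local_rep (conj_by x) 1%g 1%g (chart_at 1%g (1%g : G)) = chart_at 1%g (1%g : G).
  by rewrite /local_rep /= cmapK // conj_by1.
have dr : is_diff (chart_at 1%g (1%g : G))
    (fun u => tangent_Ad (cinv (chart_at (1%g : G)) (local_rep (conj_by x) 1%g 1%g u))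
       (tangent_Ad x w))
    (fun v => tangent_lie G (tangent_Ad x v) (tangent_Ad x w)).
  have d2 : is_diff (local_rep (conj_by x) 1%g 1%g (chart_at 1%g (1%g : G)))
      (fun u => tangent_Ad (cinv (chart_at (1%g : G)) u) (tangent_Ad x w))
      (tangent_lie G ^~ (tangent_Ad x w)).
    by rewrite c1; exact: is_diff_tangent_Ad.
  exact: (is_diff_comp (differentiableP (conj_by_diff x)) d2).
have near_lr : \forall u \near chart_at (1%g : G) 1%g,
    tangent_Ad (cinv (chart_at (1%g : G)) (local_rep (conj_by x) 1%g 1%g u))
      (tangent_Ad x w) =
    tangent_Ad x (tangent_Ad (cinv (chart_at (1%g : G)) u) w).
  have : \forall y \near (1%g : G), cdom (chart_at (1%g : G)) (conj_by x y).
    by apply: (@conj_by_continuous x 1%g); rewrite conj_by1; exact: cdom_near.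
  move/(cinv_near d1); apply: filterS => u Hu.
  have -> : cinv (chart_at (1%g : G)) (local_rep (conj_by x) 1%g 1%g u) =
      conj_by x (cinv (chart_at (1%g : G)) u) by exact: (cmapK Hu).
  rewrite -!tangent_AdM.
  by have -> y : (conj_by x y * x = x * y)%g by rewrite /conj_by mulgVK.
have [dr' Er] := dr; have [_ El] := dl.
have [_ E] := is_diff_near_eq near_lr dr'.
exact: (congr1 (@^~ v) (etrans (esym El) (etrans E Er))).
Qed.

Lemma fixed_of_diff0 N (T : G -> 'rV[R[i]]_N -> 'rV[R[i]]_N) (w : 'rV[R[i]]_N) :
  connected [set: G] -> (forall x, linear (T x)) ->
  (forall x y, T (x * y)%g w = T x (T y w)) -> T 1%g w = w ->
  is_diff (chart_at 1%g (1%g : G))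
    (fun u => T (cinv (chart_at (1%g : G)) u) w) (fun=> 0) ->
  forall x, T x w = w.
Proof.
move=> connG linT TM T1 dT.
have d1 : cdom (chart_at (1%g : G)) 1%g := chart_at_dom _.
pose W u := T (cinv (chart_at (1%g : G)) u) w.
have dW p : cdom (chart_at (1%g : G)) p -> is_diff (chart_at 1%g p) W (fun=> 0).
  move=> dp; pose Tp : {linear 'rV[R[i]]_N -> 'rV[R[i]]_N} :=
    HB.pack (T p) (GRing.isLinear.Build _ _ _ _ _ (linT p)).
  have Tp_cont : continuous Tp by exact: linear_rV_continuous.
  have dpp : cdom (chart_at (1%g : G)) (p^-1 * p)%g by rewrite mulVg.
  have dl := is_diff_lmulg (chart_at_dom p^-1%g) dp dpp.
  pose lp := local_rep (fun y => p^-1 * y)%g (1%g : G) 1%g.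
  have lp1 : lp (chart_at 1%g p) = chart_at (1%g : G) 1%g.
    by rewrite /lp /local_rep /= cmapK // mulVg.
  have dWl : is_diff (lp (chart_at 1%g p)) W (fun=> 0) by rewrite lp1.
  have dTp z : is_diff z Tp Tp.
    by apply: DiffDef;
      [exact: (linear_differentiable _ Tp_cont) | exact: (diff_lin _ Tp_cont)].
  have [dTW ETW] : is_diff (chart_at 1%g p) (Tp \o (W \o lp)) (fun=> 0).
    apply: is_diff_eq (is_diff_comp (is_diff_comp dl dWl) (dTp _)) _.
    by apply/funext => v; exact: (linear0 Tp).
  have near_TW : \forall u \near chart_at 1%g p, (Tp \o (W \o lp)) u = W u.
    have : \forall y \near p, cdom (chart_at (1%g : G)) (p^-1 * y)%g.
      by apply: (@lmulg_continuous p^-1%g p); exact: cdom_near.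
    move/(cinv_near dp); apply: filterS => u Hu /=.
    have -> : W (lp u) = T (p^-1 * cinv (chart_at (1%g : G)) u)%g w.
      by congr (T _ w); exact: (cmapK Hu).
    by rewrite -[LHS]/(T p _) -TM mulVKg.
  have [dW EW] := is_diff_near_eq near_TW dTW.
  exact: DiffDef dW (etrans EW ETW).
have near_dW : \forall u \near chart_at (1%g : G) 1%g, is_diff u W (fun=> 0).
  have nd := cinv_near d1 (cdom_near d1); have nK := cinvK_near d1.
  by apply: filterS2 nd nK => u ud uK; rewrite -uK; exact: dW.
have near_W : \forall u \near chart_at (1%g : G) 1%g, W u = w.
  have near_j j : \forall u \near chart_at (1%g : G) 1%g, W u 0 j = w 0 j.
    have -> : w 0 j = W (chart_at (1%g : G) 1%g) 0 j by rewrite /W cmapK // T1.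
    apply: (@diff0_near_cst R _ (fun u => W u 0 j : R[i]^o)).
    apply: filterS near_dW => u dWu.
    by apply: is_diff_eq (is_diff_comp dWu (is_diff_coord j _)) _;
      apply/funext => v /=; rewrite mxE.
  have nW : \forall u \near chart_at (1%g : G) 1%g, forall j, W u 0 j = w 0 j.
    exact: (@filter_forall _ _ (fun j u => W u 0 j = w 0 j) _ _ near_j).
  by apply: filterS nW => u Wu; apply/rowP.
have near1 : \forall x \near (1%g : G), T x w = w.
  have nWc : \forall x \near (1%g : G), W (chart_at 1%g x) = w.
    exact: (cmap_continuous d1 near_W).
  by apply: filterS2 (cdom_near d1) nWc => x dx; rewrite /W cmapK.
pose S := [set x | T x w = w].
have S_open : open S.
  rewrite openE => x Sx.
  have : \forall y \near x, T (x^-1 * y)%g w = w.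
    by apply: (@lmulg_continuous x^-1%g x [set z | T z w = w]); rewrite mulVg.
  by apply: filterS => y Hy; rewrite /S /= -(mulVKg x y) TM Hy.
have S_closed : closed S.
  rewrite -openC openE => x NSx.
  have : \forall y \near x, T (y^-1 * x)%g w = w.
    have iv : \forall y \near x^-1%g, T (y * x)%g w = w.
      by apply: (@rmulg_continuous x x^-1%g [set z | T z w = w]); rewrite mulVg.
    exact: (invg_holomorphic.1 x [set y | T (y * x)%g w = w] iv).
  by apply: filterS => y Hy Sy; apply: NSx; rewrite /S /= -(mulVKg y x) TM Hy.
have ST : S = [set: G].
  apply: connG; first by exists 1%g.
    by exists S => //; rewrite setTI.
  by exists S => //; rewrite setTI.
by move=> x; have : S x by rewrite ST.
Qed.

End LieGroup.

Section LieAlgebra.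
Context {K : fieldType} {g : lieAlgType K}.
Implicit Types (f h : 'End(g)) (X Y Z v : g).

HB.instance Definition _ X :=
  GRing.isLinear.Build K g g _ (lie X) (lie_linearr X).

Lemma adE X Y : ad X Y = lie X Y.
Proof. exact: lfunE. Qed.

Lemma ad_pow_morph f X k : (forall Y Z, f (lie Y Z) = lie (f Y) (f Z)) ->
  (ad_pow (f X) k \o f)%VF = (f \o ad_pow X k)%VF.
Proof.
move=> f_lie; elim: k => [|k IHk]; first by rewrite comp_lfun1l comp_lfun1r.
have ad_powS Z : ad_pow Z k.+1 = (ad Z \o ad_pow Z k)%VF by [].
rewrite !ad_powS -comp_lfunA IHk; apply/lfunP => Y.
by rewrite !comp_lfunE !adE f_lie.
Qed.

Lemma lie_antisym X Y : lie X Y = - lie Y X.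
Proof.
have lieDl Z U V : lie (U + V) Z = lie U Z + lie V Z.
  by have := lie_linearl Z 1 U V; rewrite !scale1r.
by have := liexx (X + Y); rewrite lieDl !linearD /= !liexx add0r addr0 => /eqP;
  rewrite addr_eq0 => /eqP.
Qed.

Lemma ad_lie X Y : ad (lie X Y) = ((ad X \o ad Y) - (ad Y \o ad X))%VF.
Proof.
apply/lfunP => Z; rewrite add_lfunE opp_lfunE !comp_lfunE !adE.
have := lie_jacobi X Y Z; rewrite (lie_antisym Z (lie _ _)) (lie_antisym Z X).
by rewrite linearN /= => /subr0_eq <-.
Qed.

Lemma endo_tr_linear : scalar (@endo_tr K g).
Proof. by move=> k f h; rewrite /endo_tr !linearP. Qed.

HB.instance Definition _ :=
  GRing.isLinear.Build K 'End(g) K _ (@endo_tr K g) endo_tr_linear.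

Lemma endo_tr_compC f h : endo_tr (f \o h)%VF = endo_tr (h \o f)%VF.
Proof.
by rewrite /endo_tr !(@mxof_comp _ _ _ _ _ (vbasis fullv)) ?vbasisP // mxtrace_mulC.
Qed.

Lemma ad_linear : linear (@ad K g).
Proof.
move=> k X Y; apply/lfunP => Z.
by rewrite add_lfunE scale_lfunE !adE; exact: lie_linearl.
Qed.

Lemma killing_linearr X : scalar (killing X).
Proof.
move=> k Y Z.
by rewrite /killing ad_linear comp_lfunDr -comp_lfunZr endo_tr_linear.
Qed.

Lemma killingC X Y : killing X Y = killing Y X.
Proof. exact: endo_tr_compC. Qed.

Lemma killing_invariant v X Y : killing (lie v X) Y = - killing X (lie v Y).
Proof.
rewrite /killing !ad_lie comp_lfunDl comp_lfunDr comp_lfunNl comp_lfunNr.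
have trB f h : endo_tr (f - h) = endo_tr f - endo_tr h by exact: linearB.
rewrite -!comp_lfunA !trB opprB; congr (_ - _).
by rewrite endo_tr_compC comp_lfunA.
Qed.

HB.instance Definition _ X :=
  GRing.isLinear.Build K g K _ (killing X) (killing_linearr X).

End LieAlgebra.

Section TensorProduct.
Context {K : fieldType} {U V : vectType K}.
Implicit Types (u : U) (v : V).

Lemma tensvE u v i j : tensv u v 0 (mxtens_index (i, j)) =
  rVof (vbasis {:U}) u 0 i * rVof (vbasis {:V}) v 0 j.
Proof. by rewrite /tensv mxE mxtens_indexK !ord1. Qed.

Lemma tensv_linearl v : linear (fun u => tensv u v).
Proof.
move=> k u1 u2; apply/rowP => l; case: (mxtens_indexP l) => i j.
by rewrite [in RHS]mxE [in RHS]mxE !tensvE linearP !mxE mulrDl mulrA.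
Qed.

Lemma tensv_linearr u : linear (tensv u : V -> _).
Proof.
move=> k v1 v2; apply/rowP => l; case: (mxtens_indexP l) => i j.
by rewrite [in RHS]mxE [in RHS]mxE !tensvE linearP !mxE mulrDr mulrCA.
Qed.

HB.instance Definition _ u :=
  GRing.isLinear.Build K V (tensor K U V) _ (tensv u) (tensv_linearr u).

Lemma tens_hom_linear (f : 'End(U)) (h : 'End(V)) : linear (tens_hom f h).
Proof. by move=> k w1 w2; rewrite /tens_hom mulmxDl scalemxAl. Qed.

HB.instance Definition _ f h := GRing.isLinear.Build K (tensor K U V)
  (tensor K U V) _ (tens_hom f h) (tens_hom_linear f h).

Lemma tens_hom_comp (f f' : 'End(U)) (h h' : 'End(V)) w :
  tens_hom (f \o f')%VF (h \o h')%VF w = tens_hom f h (tens_hom f' h' w).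
Proof.
rewrite /tens_hom !(@mxof_comp _ _ _ _ _ (vbasis fullv)) ?vbasisP // -mulmxA.
by rewrite tensmx_mul.
Qed.

End TensorProduct.

Section Omega.
Context {K : fieldType} {g : lieAlgType K}.
Context (d : nat) (gneg gpos : {vspace g}) (Xs Xb : d.-tuple g).
Context (dual : killing_dual_bases gneg gpos Xs Xb).

Lemma omega_ad_invariant v :
  (forall X, X \in gneg -> lie v X \in gneg) ->
  (forall X, X \in gpos -> lie v X \in gpos) ->
  \sum_(t < d) (tensv (lie v (tnth Xs t)) (tnth Xb t) +
                tensv (tnth Xs t) (lie v (tnth Xb t))) = 0.
Proof.
move=> vneg vpos; have [bpos bneg XsXb] := dual.
pose a t s := killing (lie v (tnth Xs t)) (tnth Xb s).
have as_sum t : lie v (tnth Xs t) = \sum_s a t s *: tnth Xs s.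
  have /(coord_basis bneg) E : lie v (tnth Xs t) \in gneg.
    exact/vneg/(basis_mem bneg)/mem_tnth.
  rewrite E; apply: eq_bigr => s _; rewrite -tnth_nth; congr (_ *: _).
  rewrite /a [in RHS]E killingC [RHS]linear_sum (bigD1 s) //= big1 => [|s' ss'].
    by rewrite addr0 linearZ /= -tnth_nth killingC XsXb eqxx [RHS]mulr1.
  by rewrite linearZ /= -tnth_nth killingC XsXb (negPf ss') [LHS]mulr0.
have bs_sum s : lie v (tnth Xb s) = \sum_t - a t s *: tnth Xb t.
  have /(coord_basis bpos) E : lie v (tnth Xb s) \in gpos.
    exact/vpos/(basis_mem bpos)/mem_tnth.
  rewrite E; apply: eq_bigr => t _; rewrite -tnth_nth; congr (_ *: _).
  rewrite /a killing_invariant opprK [in RHS]E [RHS]linear_sum (bigD1 t) //=.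
  rewrite big1 => [|s' ss'].
    by rewrite addr0 linearZ /= -tnth_nth XsXb eqxx [RHS]mulr1.
  by rewrite linearZ /= -tnth_nth XsXb eq_sym (negPf ss') [LHS]mulr0.
rewrite big_split /=.
have -> : \sum_t tensv (lie v (tnth Xs t)) (tnth Xb t) =
    \sum_t \sum_s a t s *: tensv (tnth Xs s) (tnth Xb t).
  apply: eq_bigr => t _; pose l : {linear g -> tensor K g g} :=
    HB.pack (fun X => tensv X (tnth Xb t))
      (GRing.isLinear.Build _ _ _ _ _ (tensv_linearl (tnth Xb t))).
  rewrite as_sum -[LHS]/(l _) linear_sum.
  by apply: eq_bigr => s _; rewrite linearZ.
have -> : \sum_s tensv (tnth Xs s) (lie v (tnth Xb s)) =
    \sum_s \sum_t - a t s *: tensv (tnth Xs s) (tnth Xb t).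
  apply: eq_bigr => s _; rewrite bs_sum linear_sum.
  by apply: eq_bigr => t _; rewrite linearZ.
rewrite [X in _ + X]exchange_big -big_split /= big1 // => t _.
by rewrite -big_split big1 // => s _; rewrite /= scaleNr subrr.
Qed.

End Omega.

Section AdjointRepresentation.
Context {R : realType} {n : nat} {G : complexLieGroupType R n}.
Context {g : lieAlgType R[i]} (lambda : 'Hom(g, 'rV[R[i]]_n)).
Context (lambda_iso : lie_algebra_iso G lambda).
Implicit Types (x y : G) (X Y : g).

Lemma lambda_inj : injective lambda.
Proof. exact: bij_inj lambda_iso.1. Qed.

Lemma lambdaK : cancel lambda lambda^-1%VF.
Proof. by apply: lker0_lfunK; apply/lker0P; exact: lambda_inj. Qed.

Lemma AdE x Y : lambda (Ad lambda x Y) = tangent_Ad x (lambda Y).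
Proof.
have [f _ fK] := lambda_iso.1.
have -> : Ad lambda x Y = lambda^-1%VF (tangent_Ad x (lambda Y)).
  by rewrite /Ad !comp_lfunE; congr (lambda^-1%VF _); exact: lfunE.
by rewrite -[X in lambda^-1%VF X]fK lambdaK fK.
Qed.

Lemma Ad1 : Ad lambda (1%g : G) = \1%VF.
Proof. by apply/lfunP => Y; apply: lambda_inj; rewrite AdE tangent_Ad1 id_lfunE. Qed.

Lemma AdM x y : Ad lambda (x * y)%g = (Ad lambda x \o Ad lambda y)%VF.
Proof.
by apply/lfunP => Y; apply: lambda_inj; rewrite comp_lfunE !AdE tangent_AdM.
Qed.

Lemma Ad_lie x X Y : Ad lambda x (lie X Y) = lie (Ad lambda x X) (Ad lambda x Y).
Proof.
by apply: lambda_inj; rewrite AdE !lambda_iso.2 tangent_Ad_lie !AdE.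
Qed.

Lemma is_diff_Ad m (H : complexLieGroupType R m) (iota : H -> G) Y :
  iota 1%g = 1%g -> holomorphic_map iota -> forall i,
  is_diff (chart_at 1%g (1%g : H))
    (fun u => rVof (vbasis {:g}) (Ad lambda (iota (cinv (chart_at (1%g : H)) u)) Y) 0 i : R[i]^o)
    (fun v => rVof (vbasis {:g}) (lie (lambda^-1%VF (mdiff iota 1%g v)) Y) 0 i).
Proof.
move=> iota1 [ci hi] i; have [f fK fK'] := lambda_iso.1.
have d1 : cdom (chart_at (1%g : H)) 1%g := chart_at_dom _.
have d1G : cdom (chart_at (1%g : G)) 1%g := chart_at_dom _.
pose phi z : R[i]^o := rVof (vbasis {:g}) (lambda^-1%VF z) 0 i.
have phi_lin : linear phi by move=> k a b; rewrite /phi linearP [rVof _ _]linearP !mxE.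
pose phiL : {linear 'rV[R[i]]_n -> R[i]^o} :=
  HB.pack phi (GRing.isLinear.Build _ _ _ _ _ phi_lin).
have phi_cont : continuous phiL by exact: linear_rV_continuous.
have dphi z : is_diff z phi phi.
  by apply: DiffDef;
    [exact: (linear_differentiable _ phi_cont) | exact: (diff_lin _ phi_cont)].
pose rep := local_rep iota 1%g 1%g.
have drep : is_diff (chart_at 1%g (1%g : H)) rep (mdiff iota 1%g).
  rewrite /mdiff iota1; apply: differentiableP.
  have [d _] := hi 1%g 1%g 1%N; apply: d.
  by exists 1%g => //; split => //=; rewrite iota1.
have rep1 : rep (chart_at 1%g (1%g : H)) = chart_at 1%g (1%g : G).
  by rewrite /rep /local_rep /= cmapK // iota1.
have dAd : is_diff (rep (chart_at 1%g (1%g : H)))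
    (fun u => tangent_Ad (cinv (chart_at (1%g : G)) u) (lambda Y))
    (tangent_lie G ^~ (lambda Y)).
  by rewrite rep1; exact: is_diff_tangent_Ad.
have [dc Ec] := is_diff_comp (is_diff_comp drep dAd) (dphi _).
have near_c : \forall u \near chart_at 1%g (1%g : H),
    (phi \o ((fun u => tangent_Ad (cinv (chart_at (1%g : G)) u) (lambda Y)) \o rep)) u =
    rVof (vbasis {:g}) (Ad lambda (iota (cinv (chart_at (1%g : H)) u)) Y) 0 i.
  have near_dom : \forall x \near (1%g : H), cdom (chart_at (1%g : G)) (iota x).
    by apply: ci; rewrite iota1; exact: cdom_near.
  apply: filterS (cinv_near d1 near_dom) => u Hu.
  have repK : cinv (chart_at (1%g : G)) (rep u) = iota (cinv (chart_at (1%g : H)) u).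
    exact: (cmapK Hu).
  by rewrite -[in RHS](lambdaK (Ad _ _ _)) AdE -repK.
have lieE z : lambda^-1%VF (tangent_lie G z (lambda Y)) = lie (lambda^-1%VF z) Y.
  have [X ->] : exists X, z = lambda X by exists (f z); rewrite fK'.
  by rewrite -lambda_iso.2 !lambdaK.
have [d E] := is_diff_near_eq near_c dc.
apply: DiffDef d (etrans E (etrans Ec _)); apply/funext => v.
exact: (congr1 (fun z => rVof (vbasis {:g}) z 0 i) (lieE _)).
Qed.

End AdjointRepresentation.

Lemma omega_Ad_invariant (R : realType) (g : lieAlgType R[i])
    (r : nat) (gr : int -> {vspace g}) (gr_graded : lie_grading r gr)
    (n : nat) (G : complexLieGroupType R n)
    (lambda : 'Hom(g, 'rV[R[i]]_n)) (lambda_iso : lie_algebra_iso G lambda)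
    (L : set G) (L_analytic : analytic_subgroup lambda (gr 0) L)
    (d : nat) (Xs Xb : d.-tuple g)
    (dual : killing_dual_bases (gr (- r%:Z)) (gr r%:Z) Xs Xb) (l : G) :
  L l -> tens_hom (Ad lambda l) (Ad lambda l) (omega Xs Xb) = omega Xs Xb.
Proof.
have [m [H [iota [connH [_ <-] hol _ limg_iota]]]] := L_analytic.
move=> [h _ <-].
have iota1 : iota 1%g = 1%g.
  by apply: (@mulgI _ (iota 1%g)); rewrite -gmulfM !mulg1.
pose T x := tens_hom (Ad lambda (iota x)) (Ad lambda (iota x)).
have linT x : linear (T x) by exact: tens_hom_linear.
have TM x y : T (x * y)%g (omega Xs Xb) = T x (T y (omega Xs Xb)).
  by rewrite /T gmulfM (AdM lambda_iso) tens_hom_comp.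
have T1 : T 1%g (omega Xs Xb) = omega Xs Xb.
  rewrite /T iota1 (Ad1 lambda_iso) /omega linear_sum; apply: eq_bigr => t _.
  by rewrite /= tens_homE !id_lfunE.
apply: (fixed_of_diff0 connH linT TM T1); apply: is_diff_rV => k.
case: (mxtens_indexP k) => i j.
pose c (i' : 'I_(\dim {:g})) Y u : R[i]^o :=
  rVof (vbasis {:g}) (Ad lambda (iota (cinv (chart_at (1%g : H)) u)) Y) 0 i'.
pose dc (i' : 'I_(\dim {:g})) Y v : R[i]^o :=
  rVof (vbasis {:g}) (lie (lambda^-1%VF (mdiff iota 1%g v)) Y) 0 i'.
have dcP i' Y : is_diff (chart_at 1%g (1%g : H)) (c i' Y) (dc i' Y).
  exact: (is_diff_Ad lambda_iso).
have [D E] := is_diff_sum (fun t : 'I_d => is_diffM (dcP i (tnth Xs t)) (dcP j (tnth Xb t))).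
have -> : (fun u => T (cinv (chart_at (1%g : H)) u) (omega Xs Xb) 0
      (mxtens_index (i, j)) : R[i]^o) =
    \sum_(t < d) (c i (tnth Xs t) * c j (tnth Xb t)).
  apply/funext => u; rewrite fct_sumE /T /omega linear_sum summxE.
  by apply: eq_bigr => t _; rewrite /= tens_homE tensvE.
apply: DiffDef D (etrans E _); apply/funext => v.
have c0 i' Y : c i' Y (chart_at 1%g (1%g : H)) = rVof (vbasis {:g}) Y 0 i'.
  rewrite /c cmapK; last exact: chart_at_dom.
  by rewrite iota1 (Ad1 lambda_iso) id_lfunE.
set V := lambda^-1%VF (mdiff iota 1%g v).
have V0 : V \in gr 0.
  have : mdiff iota 1%g v \in (lambda @: gr 0%R)%VS.
    rewrite -limg_iota.
    have <- : linfun (mdiff iota (1%g : H)) v = mdiff iota 1%g v by exact: lfunE.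
    exact: memv_img (memvf v).
  by case/memv_imgP => Z Z0; rewrite /V => ->; rewrite (lambdaK lambda_iso).
have Vgr q Z : Z \in gr q -> lie V Z \in gr q.
  by move=> Zq; rewrite -[q]add0r; exact: (grading_lie gr_graded).
have := omega_ad_invariant dual (Vgr _) (Vgr _).
move/(congr1 (fun w : tensor R[i] g g => w 0 (mxtens_index (i, j)))).
rewrite summxE [X in _ = X]mxE => Esum.
apply: (etrans _ (etrans Esum _)); last by rewrite mxE.
rewrite fct_sumE; apply: eq_bigr => t _.
by rewrite !fctE !c0 [RHS]mxE !tensvE addrC; congr (_ + _); rewrite mulrC.
Qed.

Theorem lemma3p3 (R : realType) (g : lieAlgType R[i]) (g_simple : lie_simple g)
    (r : nat) (gr : int -> {vspace g}) (gr_graded : lie_grading r gr)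
    (gr1_neq0 : gr 1 <> 0%VS)
    (n : nat) (G : complexLieGroupType R n) (G_connected : connected [set: G])
    (lambda : 'Hom(g, 'rV[R[i]]_n)) (lambda_iso : lie_algebra_iso G lambda)
    (L : set G) (L_analytic : analytic_subgroup lambda (gr 0) L)
    (d : nat) (Xs Xb : d.-tuple g)
    (dual : killing_dual_bases (gr (- r%:Z)) (gr r%:Z) Xs Xb)
    (l : G) (lL : L l) (X : g) (X_gr1 : X \in gr 1) (k : nat)
    (k_le : (k <= 2 * r)%N) :
  tau Xs Xb k (Ad lambda l X) =
  tens_hom (Ad lambda l) (Ad lambda l) (tau Xs Xb k X).
Proof.
have inv_omega := omega_Ad_invariant gr_graded lambda_iso L_analytic dual lL.
rewrite /tau linearZ -[in LHS]inv_omega; congr (_ *: _).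
rewrite /= -!tens_hom_comp comp_lfun1l comp_lfun1r.
by rewrite (ad_pow_morph _ _ (Ad_lie lambda_iso l)).
Qed.
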